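(* Let $P\in\mathcal{P}_o^n$, let $1\le l<k\le n$, and let $\xi_i^k\in \{\xi_1^k,\xi_2^k,\dots,\xi_{m_k}^k\}$. Then $$X_l(P;\xi_i^k)^n=\sum_{\{j\in\{1,\dots,m_l\}:\,\xi_j^l\subseteq \xi_i^k\}} X_l(P;\xi^l_j)^n.$$
   Context: $\mathcal{P}_o^n$ is the set of polytopes in $\mathbb{R}^n$ with the origin $o$ in their interiors. Let $u_1,\dots,u_N$ be the (distinct) unit outer normal vectors of the facets of $P$. $V_P(\{u_i\})$ is the volume of the convex hull of $o$ and the facet of $P$ with outer normal $u_i$. For a linear subspace $\xi$ of $\mathbb{R}^n$ and $k\in\{1,\dots,n\}$, the quantity $X_k(P;\xi)\ge0$ is defined by $$X_{k}(P;\xi)^{n}=\sum_{\substack{u_{i_1}, \ldots, u_{i_n}\in \xi \\ \dim(\mathrm{span}\{u_{i_1},\ldots,u_{i_n}\})=k}} V_{P}(\{u_{i_1}\}) \cdots V_{P}(\{u_{i_n}\}),$$ the sum being over all ordered $n$-tuples $(i_1,\dots,i_n)\in\{1,\dots,N\}^n$ (repetitions allowed) satisfying the two conditions. For $k\in\{1,\dots,n\}$, $\{\xi_1^k,\dots,\xi_{m_k}^k\}$ is the set of all $k$-dimensional linear subspaces spanned by unit outer normals of $P$, listed without repetition (so it has exactly $m_k$ elements): $$\{\xi_1^k,\dots,\xi_{m_k}^k\}=\{\mathrm{span}\{u_{i_1},\dots,u_{i_n}\}: i_1,\dots,i_n\in\{1,\dots,N\},\ \dim(\mathrm{span}\{u_{i_1},\dots,u_{i_n}\})=k\}.$$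 *)

(* Defs.v *)
From HB Require Import structures.
From mathcomp Require Import all_boot all_order all_algebra finmap.
From mathcomp Require Import all_classical all_reals all_analysis.
From mathcomp Require Import lra.
Set Implicit Arguments.
Unset Strict Implicit.
Unset Printing Implicit Defensive.
Import Order.TTheory GRing.Theory Num.Theory.
Import numFieldNormedType.Exports.

Local Open Scope classical_set_scope.
Local Open Scope ring_scope.

Section Defs.
Context {R : realType} {n : nat}.
Implicit Types (P A : set 'rV[R]_n) (u x y : 'rV[R]_n).

(* The library norm on matrices is the sup norm, so Euclidean notions are
   expressed through this product. *)
Definition dot x y : R := \sum_i x 0 i * y 0 i.

Definition conv_hull A : set 'rV[R]_n := smallest (@convex_set R 'rV[R]_n) A.

Definition polytope P := exists2 A, finite_set A & P = conv_hull A.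

Definition polytope_o P := polytope P /\ P° 0.

(* The dimension of a nonempty set is that of its affine hull x0 + W, where W
   is the least linear subspace containing A - x0. *)
Definition has_dim A (d : nat) := exists x0 (W : {vspace 'rV[R]_n}),
  [/\ A x0,
      forall x, A x -> x - x0 \in W,
      forall U : {vspace 'rV[R]_n},
        (forall x, A x -> x - x0 \in U) -> (W <= U)%VS
    & \dim W = d].

(* The intersection of P with its supporting hyperplane of outer normal u. *)
Definition face P u := [set x | P x /\ forall y, P y -> dot y u <= dot x u].

Definition facet_normal P : set 'rV[R]_n :=
  [set u | dot u u = 1 /\ has_dim (face P u) n.-1].

Definition box (a b : 'rV[R]_n) : set 'rV[R]_n :=
  [set x : 'rV[R]_n | forall i, a 0 i <= x 0 i <= b 0 i].

(* n-dimensional Lebesgue outer measure; on measurable sets, in particular on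
   compact ones, it is the volume. *)
Definition volume A : \bar R := ereal_inf
  [set v | exists a b : nat -> 'rV[R]_n,
    [/\ forall j i, a j 0 i <= b j 0 i,
        A `<=` \bigcup_j box (a j) (b j)
      & v = (\sum_(0 <= j <oo) (\prod_i (b j 0 i - a j 0 i))%:E)%E]].

Definition cone_volume P u : R :=
  fine (volume (conv_hull ([set 0] `|` face P u))).

(* [fset_set] of an infinite set is empty; see [finite_facet_normal]. *)
Definition normals P : {fset 'rV[R]_n} := fset_set (facet_normal P).

Definition tspan P (t : n.-tuple (normals P)) : {vspace 'rV[R]_n} :=
  <<map val t>>%VS.

Definition Xfun P (k : nat) (xi : {vspace 'rV[R]_n}) : R :=
  (\sum_(t : n.-tuple (normals P) |
         all (fun u : normals P => val u \in xi) t && (\dim (tspan t) == k))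
     \prod_(u <- t) cone_volume P (val u)) `^ n%:R^-1.

(* The set {xi_1^k, ..., xi_{m_k}^k}. *)
Definition normal_spans P (k : nat) : {fset {vspace 'rV[R]_n}} :=
  [fset tspan t | t in {: n.-tuple (normals P)} & \dim (tspan t) == k]%fset.

Lemma dotDl x y u : dot (x + y) u = dot x u + dot y u.
Proof. by rewrite -big_split; apply: eq_bigr => i _; rewrite mxE mulrDl. Qed.

Lemma dotZl a x u : dot (a *: x) u = a * dot x u.
Proof. by rewrite mulr_sumr; apply: eq_bigr => i _; rewrite mxE mulrA. Qed.

Lemma dotC x y : dot x y = dot y x.
Proof. by apply: eq_bigr => i _; rewrite mulrC. Qed.

Lemma dotNl x u : dot (- x) u = - dot x u.
Proof. by rewrite -scaleN1r dotZl mulN1r. Qed.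

Lemma dotBl x y u : dot (x - y) u = dot x u - dot y u.
Proof. by rewrite dotDl dotNl. Qed.

Lemma dot_eq0 x : dot x x = 0 -> x = 0.
Proof.
move=> /eqP; rewrite psumr_eq0 => [/allP x0|i _]; last exact: sqr_ge0.
apply/rowP => i; rewrite mxE; apply/eqP.
by have := x0 i (mem_index_enum i); rewrite mulf_eq0 orbb.
Qed.

Lemma dot_mulmx x u : dot x u = (x *m u^T) 0 0.
Proof. by rewrite mxE; apply: eq_bigr => i _; rewrite mxE. Qed.

Lemma convex_setP A : (forall x y (t : R), A x -> A y -> 0 <= t -> t <= 1 ->
  A (t *: x + (1 - t) *: y)) <-> @convex_set R 'rV[R]_n A.
Proof.
split=> [Ac x y t /set_mem Ax /set_mem Ay|Ac x y t Ax Ay t0 t1].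
  by apply/mem_set; apply: Ac.
have tI : Itv.spec (@Itv.num_sem R) (Itv.Real `[0%Z, 1%Z]) t.
  by apply/and3P; split; rewrite ?num_real//= in_itv/= t0 t1.
by have /set_mem := Ac x y (Itv.mk tI) (mem_set Ax) (mem_set Ay).
Qed.

Lemma sub_conv_hull A : A `<=` conv_hull A.
Proof. exact: sub_smallest. Qed.

Lemma conv_hull_sub A P :
  A `<=` P -> @convex_set R 'rV[R]_n P -> conv_hull A `<=` P.
Proof. by move=> AP Pc; apply: smallest_sub. Qed.

Lemma conv_hull_convex A : @convex_set R 'rV[R]_n (conv_hull A).
Proof.
apply/convex_setP => x y t Ax Ay t0 t1 B AB.
by case: (AB) => /convex_setP Bc _; apply: Bc => //; [exact: Ax | exact: Ay].
Qed.

Lemma face_convex P u : @convex_set R 'rV[R]_n P ->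
  @convex_set R 'rV[R]_n (face P u).
Proof.
move=> /convex_setP Pc; apply/convex_setP => x y t [Px xu] [Py yu] t0 t1.
split; first exact: Pc.
move=> z Pz; rewrite dotDl !dotZl.
have := xu z Pz; have := yu z Pz; nra.
Qed.

Lemma face_conv_hull A u :
  face (conv_hull A) u `<=` conv_hull (A `&` face (conv_hull A) u).
Proof.
move=> x [Px xu].
pose C := conv_hull (A `&` face (conv_hull A) u) `|`
  [set y : 'rV[R]_n | dot y u < dot x u].
have Cc : @convex_set R 'rV[R]_n C.
  have Fx y : conv_hull (A `&` face (conv_hull A) u) y ->
      dot y u = dot x u.
    have Fc := @face_convex _ u (@conv_hull_convex A).
    move=> /(conv_hull_sub (@subIsetr _ A _) Fc)[Py yu].
    by apply/eqP; rewrite eq_le xu// yu.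
  apply/convex_setP => y z t Cy Cz t0 t1.
  have [->|tn0] := eqVneq t 0; first by rewrite scale0r subr0 scale1r add0r.
  have [->|tn1] := eqVneq t 1; first by rewrite subrr scale0r scale1r addr0.
  have {}t0 : 0 < t by rewrite lt_def tn0.
  have {}t1 : t < 1 by rewrite lt_neqAle tn1.
  case: Cy Cz => [yF|/= yx] [zF|/= zx].
  - by left; move/convex_setP: (@conv_hull_convex (A `&` face (conv_hull A) u));
      apply => //; exact: ltW.
  - by right; rewrite /= dotDl !dotZl (Fx y)//; nra.
  - by right; rewrite /= dotDl !dotZl (Fx z)//; nra.
  - by right; rewrite /= dotDl !dotZl; nra.
have AC : A `<=` C.
  move=> a Aa; have Pa := sub_conv_hull Aa.
  have := xu a Pa; rewrite le_eqVlt => /predU1P[ax|]; last by right.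
  left; apply: sub_conv_hull; split => //; split=> // y Py.
  by rewrite ax; exact: xu.
by have [//|/=] := conv_hull_sub AC Cc Px; rewrite ltxx.
Qed.

Lemma facet_support_gt0 P u x : P° 0 -> dot u u = 1 -> face P u x ->
  0 < dot x u.
Proof.
move=> P0 u1 [_ xu].
have cu : (fun e : R => e *: u) @ 0^'+ --> (0 : 'rV[R]_n).
  have -> : (0 : 'rV[R]_n) = 0 *: u by rewrite scale0r.
  by apply: cvgZr_tmp; apply: cvg_at_right_filter; exact: cvg_id.
have Pe : \forall e \near (0 : R)^'+, P (e *: u) by exact: cu.
near (0 : R)^'+ => e.
have e0 : 0 < e by near: e; exact: nbhs_right_gt.
apply: (@lt_le_trans _ _ e) => //.
by rewrite -[e]mulr1 -u1 -dotZl; apply: xu; near: e.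
Unshelve. all: by end_near. Qed.

Lemma facet_normal_inj A u v : (conv_hull A)° 0 ->
  facet_normal (conv_hull A) u -> facet_normal (conv_hull A) v ->
  A `&` face (conv_hull A) u = A `&` face (conv_hull A) v -> u = v.
Proof.
set P := conv_hull A => P0 [u1 [x0 [W [x0u FW Wmin Wdim]]]] [v1 _] Auv.
have FuFv : face P u `<=` face P v.
  move=> x /face_conv_hull; rewrite -/P Auv; apply: conv_hull_sub.
    exact: subIsetr.
  exact/face_convex/conv_hull_convex.
have x0v := FuFv _ x0u.
have hu := facet_support_gt0 P0 u1 x0u.
have hv := facet_support_gt0 P0 v1 x0v.
have Fcst w x y : face P w x -> face P w y -> dot x w = dot y w.
  by move=> [Px xw] [Py yw]; apply/eqP; rewrite eq_le xw// yw.
pose orth w : {vspace 'rV[R]_n} := lker (linfun (mulmxr w^T : 'rV[R]_n -> 'rV[R]_1)).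
have orthP w x : (x \in orth w) = (dot x w == 0).
  rewrite memv_ker lfunE/= dot_mulmx; apply/eqP/eqP => [->|xw]; first by rewrite mxE.
  by apply/matrixP => i j; rewrite !ord1 xw mxE.
have Worth w : face P u `<=` face P w -> (W <= orth w)%VS.
  move=> Fuw; apply: Wmin => x Fx; rewrite orthP dotBl subr_eq0; apply/eqP.
  by apply: Fcst; exact: Fuw.
have n0 : (0 < n)%N.
  rewrite lt0n; apply/eqP => n0; move: u1; rewrite /dot big1 => [/eqP|i _].
    by rewrite eq_sym oner_eq0.
  by have := ltn_ord i; rewrite {2}n0.
have x0W : x0 \notin W.
  apply/negP => /(subvP (Worth u (fun _ => id))); rewrite orthP => /eqP u0.
  by rewrite u0 ltxx in hu.
have x00 : x0 != 0 by apply: contraNneq x0W => ->; exact: mem0v.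
have full : (W + <[x0]>)%VS = fullv.
  apply/eqP; rewrite eqEdim subvf /= dimvf /dim/= mul1n.
  rewrite dimv_disjoint_sum ?Wdim ?dim_vline ?x00 ?addn1 ?prednK//.
  apply/eqP; rewrite -subv0; apply/subvP => x; rewrite memv_cap.
  case/andP => xW /vlineP[c xc]; rewrite memv0 xc scaler_eq0; apply/orP; left.
  apply: contraNT x0W => c0; rewrite -[x0](scalerK c0) -xc.
  exact: memvZ.
pose w := dot x0 v *: u - dot x0 u *: v.
have w0 : w = 0.
  apply: dot_eq0; apply/eqP; rewrite -orthP.
  suff /subvP : (fullv <= orth w)%VS by apply; exact: memvf.
  rewrite -full subv_add; apply/andP; split.
    apply/subvP => x xW; rewrite orthP dotC dotBl !dotZl (dotC u) (dotC v).
    have := subvP (Worth u (fun _ => id)) x xW; rewrite orthP => /eqP->.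
    have := subvP (Worth v FuFv) x xW; rewrite orthP => /eqP->.
    by rewrite !mulr0 subrr.
  apply/subvP => _ /vlineP[c ->]; rewrite orthP dotZl dotC dotBl !dotZl.
  by rewrite (dotC u) (dotC v) mulrC [X in X - _]mulrC subrr mul0r.
have uv : dot x0 v *: u = dot x0 u *: v by apply/eqP; rewrite -subr_eq0 -/w w0.
have : dot (dot x0 v *: u) (dot x0 v *: u) = dot (dot x0 u *: v) (dot x0 u *: v).
  by rewrite uv.
rewrite !dotZl !(dotC _ (_ *: _)) !dotZl u1 v1 !mulr1 -!expr2 => /eqP.
rewrite eqrXn2 ?ltW// => /eqP h; move: uv; rewrite h => /scalerI; apply.
by rewrite gt_eqF.
Qed.

Lemma finite_facet_normal P : polytope_o P -> finite_set (facet_normal P).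
Proof.
move=> [[A Afin ->] P0].
pose f u := fset_set (A `&` face (conv_hull A) u).
have Ffin u : finite_set (A `&` face (conv_hull A) u) by exact: finite_setIl.
have finj : {in facet_normal (conv_hull A) &, injective f}.
  move=> u v /set_mem uF /set_mem vF fuv; apply: (facet_normal_inj P0) => //.
  exact: fset_set_inj (Ffin u) (Ffin v) fuv.
rewrite -(eq_finite_set (inj_card_eq finj)).
apply: (sub_finite_set _ (finite_fset (fpowerset (fset_set A)))).
move=> _ [u _ <-]; rewrite /= fpowersetE.
by rewrite -fset_set_sub//; exact: subIsetl.
Qed.

End Defs.

(* Main.v *)
(* Group the tuples t of normals in xi with l-dimensional span by their span:
   an l-dimensional eta contains all members of such a t iff eta = span t. *)
Require Import Defs.
From mathcomp Require Import all_boot all_order all_algebra finmap.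
From mathcomp Require Import all_classical all_reals all_analysis.
Import Order.TTheory GRing.Theory Num.Theory.
Local Open Scope classical_set_scope.
Local Open Scope ring_scope.

Section NormalSpans.
Context {R : realType} {n : nat}.
Implicit Types (P : set 'rV[R]_n) (xi : {vspace 'rV[R]_n}).

(** Both sides add up the same products of cone volumes over tuples [t] of normals, so it suffices
    that each [t] counted on the left is counted exactly once on the right. Its span has dimension
    [l] and lies in [xi], hence is itself an admissible [eta]; any other [eta] containing it would
    have the same dimension and so equal it. [Xfun_expn] removes the root, and [Xfun_expn_sum] does
    the double counting. *)

Lemma cone_volume_ge0 P (u : 'rV[R]_n) : 0 <= cone_volume P u.
Proof.
apply: fine_ge0; apply: le_ereal_inf_tmp => _ [a [b [ab _ ->]]].
apply: nneseries_ge0 => j _ _; rewrite lee_fin; apply: prodr_ge0 => i _.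
by rewrite subr_ge0.
Qed.

Lemma tspan_subE P (t : n.-tuple (normals P)) xi :
  all (fun u : normals P => val u \in xi) t = (tspan t <= xi)%VS.
Proof.
apply/allP/span_subvP => [tx _ /mapP[u ut ->]|tx u ut]; first exact: tx.
by apply: tx; exact: map_f.
Qed.

(** The [n]-th power undoes the real power [n^-1] because [n] is nonzero and the sum under the root
    is nonnegative. *)
Lemma Xfun_expn P k xi : (0 < n)%N ->
  Xfun P k xi ^+ n =
  \sum_(t : n.-tuple (normals P) | (tspan t <= xi)%VS && (\dim (tspan t) == k))
     \prod_(u <- t) cone_volume P (val u).
Proof.
move=> n0; rewrite /Xfun -powR_mulrn ?powR_ge0// -powRrM mulVf ?pnatr_eq0 -?lt0n//.
rewrite powRr1; last first.
  by apply: sumr_ge0 => t _; apply: prodr_ge0 => u _; exact: cone_volume_ge0.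
by apply: eq_bigl => t; rewrite tspan_subE.
Qed.

Lemma Xfun_expn_sum P l xi : (0 < n)%N ->
  Xfun P l xi ^+ n =
  \sum_(eta <- normal_spans P l | (eta <= xi)%VS) Xfun P l eta ^+ n.
Proof.
move=> n0; under [RHS]eq_bigr do rewrite Xfun_expn//.
(* Swap the sums over [eta] and [t]; a tuple with span in some [eta <= xi] has its span in [xi]. *)
rewrite Xfun_expn// (exchange_big_dep (fun t : n.-tuple (normals P) =>
  (tspan t <= xi)%VS && (\dim (tspan t) == l)))/=; last first.
  by move=> eta t ex /andP[/subv_trans -> // ->].
apply: eq_bigr => t /andP[tx tl].
have tS : tspan t \in normal_spans P l by apply/imfsetP; exists t.
(* For fixed [t] only [eta = tspan t] survives, and it is listed once. *)
transitivity (\sum_(eta <- normal_spans P l | eta == tspan t)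
    \prod_(u <- t) cone_volume P (val u)).
  by rewrite -[RHS]big_filter (filter_pred1_uniq (fset_uniq _)) ?big_seq1.
(* Membership in [normal_spans P l] is kept as a condition since it gives [\dim eta = l], which
   turns [tspan t <= eta] into equality. *)
rewrite big_seq_cond [RHS]big_seq_cond; apply: eq_bigl => eta /=.
case etaS: (eta \in _) => //=.
have {etaS} /eqP etal : \dim eta == l by case/imfsetP: etaS => s /= ? ->.
rewrite tl andbT; apply/eqP/andP => [->|[_ te]]; first by [].
by apply/esym/eqP; rewrite eqEdim te etal (eqP tl) leqnn.
Qed.

End NormalSpans.

Theorem lemma3p2 (R : realType) (n : nat) (P : set 'rV[R]_n)
  (hP : polytope_o P) (l k : nat) (hl : (1 <= l)%N) (hlk : (l < k)%N)
  (hkn : (k <= n)%N) (xi : {vspace 'rV[R]_n}) (hxi : xi \in normal_spans P k) :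
  Xfun P l xi ^+ n =
  \sum_(eta <- normal_spans P l | (eta <= xi)%VS) Xfun P l eta ^+ n.
Proof. by apply: Xfun_expn_sum; apply: leq_trans hkn; exact: leq_ltn_trans hlk. Qed.
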